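(* Let $s,f,n$ be positive integers. Then there is a constant $\alpha(s,f,n)$ such that for all $x\in\Sigma_s^n$ and $y\in\Sigma_f^n$ $$\alpha(s,f,n)\,\|x\|_2\|y\|_1\le\|x*y\|_2,$$ and this lower bound satisfies $$\alpha(s,f,n)>2^{-f^2\log_2\frac{sf}{4}+f\log_2\frac s2-\frac32\log_2(4f)}\;n^{-f^2+f-1}.$$ If $s=f$, then $$\alpha(s,s,n)>2^{-(2s^2-s+1)\log_2\frac s2}\;n^{-s^2+s-\frac12}.$$
   Context: $\Sigma_k^n$ is the set of vectors in $\mathbb C^n$ (indexed by $\{0,\dots,n-1\}$) with at most $k$ non-zero entries; such vectors are regarded as sequences on $\mathbb Z$ by extending them by zero. Convolution is the (non-circular) convolution on $\mathbb Z$: $(x*y)(g)=\sum_{h\in\mathbb Z}x(h)y(g-h)$. $\|\cdot\|_p$ is the usual $\ell^p$ norm.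
   Formalization: The bound for s=f is claimed except when s=1, n≤16 or s=2, n=1: there x=y=δ₀ forces α≤1 while the stated strict lower bound (4/√n, resp. n^{-5/2}) is at least 1, so the claim is false; everything else is unchanged. *)

(* Defs.v *)
From HB Require Import structures.
From mathcomp Require Import all_boot all_order all_algebra.
From mathcomp Require Import all_classical all_reals all_analysis.
From mathcomp Require Import complex.

Set Implicit Arguments.
Unset Strict Implicit.
Unset Printing Implicit Defensive.

Import Order.TTheory GRing.Theory Num.Theory.

Local Open Scope classical_set_scope.
Local Open Scope ring_scope.
Local Open Scope complex_scope.

Section SparseConvolution.
Variable R : realType.

Definition Sigma (k n : nat) : set 'rV[R[i]]_n :=
  [set x : 'rV[R[i]]_n | (#|[pred i | x ord0 i != 0%R]| <= k)%N].

Definition extZ (n : nat) (x : 'rV[R[i]]_n) (g : int) : R[i] :=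
  if g is Posz m then oapp (x ord0) 0 (insub m : option 'I_n) else 0.

(* The sum over int is a finite-support sum: it is the intended series when u
   or v has finite support, as is the case for extZ x and extZ y. *)
Definition convolution (u v : int -> R[i]) (g : int) : R[i] :=
  \sum_(h \in [set: int]) u h * v (g - h).

(* Valued in the extended reals: +oo when u is not p-summable. *)
Definition lpnorm (p : R) (u : int -> R[i]) : \bar R :=
  ((\esum_(g in [set: int]) (ComplexField.Normc.normc (u g) `^ p)%:E) `^ p^-1)%E.

Definition log2 (x : R) : R := ln x / ln 2.

End SparseConvolution.

Arguments Sigma R k n : clear implicits.

(* Main.v *)
Require Import Defs.
From HB Require Import structures.
From mathcomp Require Import all_boot all_order all_algebra.
From mathcomp Require Import all_classical all_reals all_analysis.
From mathcomp Require Import complex.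
From mathcomp Require Import zify ring lra.

(* Sample the Fourier transforms X, Y of x, y at the N-th roots of unity, and let E be the
   set of samples where |Y| < eps.  By Turan's argument, f consecutive samples cannot all
   lie in E if eps = (2/N)^(f-1) |y|_1 / f.  On the other hand the boundary of E consists of
   at most 2(n-1) gaps between samples, since each of them contains a zero of a polynomial
   of degree 2(n-1) that vanishes where |Y| takes a fixed value close to eps.  Hence
   |E| <= (n-1)(f-1).  As |X|^2 <= s |x|_2^2 pointwise, Parseval's identity yields
     N |x*y|_2^2 >= eps^2 (N - s |E|) |x|_2^2,
   and it remains to choose N of order s n f. *)

Import Order.TTheory GRing.Theory Num.Theory.
Import numFieldNormedType.Exports.

Local Open Scope classical_set_scope.
Local Open Scope ring_scope.

Local Notation normc := ComplexField.Normc.normc.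

(** * The unit circle *)

Section UnitCircle.
Variable R : realType.
Implicit Types (z : R[i]) (t : R).

Lemma normcE z : `|z| = ((normc z)%:C)%C. Proof. by []. Qed.

Lemma normc_ge0 z : 0 <= normc z.
Proof. by case: z => a b; exact: sqrtr_ge0. Qed.

Lemma normcX z m : normc (z ^+ m) = normc z ^+ m.
Proof.
elim: m => [|m IH]; first by rewrite !expr0 ComplexField.Normc.normc1.
by rewrite !exprS ComplexField.Normc.normcM IH.
Qed.

Lemma normc_sqr z : normc z ^+ 2 = complex.Re z ^+ 2 + complex.Im z ^+ 2.
Proof. by case: z => a b; rewrite sqr_sqrtr//= addr_ge0 ?sqr_ge0. Qed.

Lemma normc_eq0 z : (normc z == 0) = (z == 0).
Proof.
apply/eqP/eqP => [/ComplexField.Normc.eq0_normc//|->].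
by rewrite ComplexField.Normc.normc0.
Qed.

Definition expi t : R[i] := (cos t +i* sin t)%C.

Lemma expiD t u : expi (t + u) = expi t * expi u.
Proof. by rewrite /expi cosD sinD; simpc; congr Complex; rewrite addrC. Qed.

Lemma expi0 : expi 0 = 1.
Proof. by rewrite /expi cos0 sin0. Qed.

Lemma expiMn t m : expi (t *+ m) = expi t ^+ m.
Proof. by elim: m => [|m IH]; rewrite ?mulr0n ?expi0 ?expr0// mulrS expiD IH exprS. Qed.

Lemma normc_expi t : normc (expi t) = 1.
Proof. by rewrite /= cos2Dsin2 sqrtr1. Qed.

Lemma expi2pi : expi (pi *+ 2) = 1.
Proof. by rewrite /expi cos2pi sin2pi. Qed.

Lemma normc_expiB t u : normc (expi t - expi u) = 2 * `|sin ((t - u) / 2)|.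
Proof.
apply/eqP; rewrite -(@eqrXn2 _ 2) ?mulr_ge0 ?normc_ge0//; apply/eqP.
rewrite normc_sqr /= exprMn -normrX ger0_norm ?sqr_ge0//.
have -> : t = u + (t - u) / 2 *+ 2 by field.
set h := (t - u) / 2; have -> : (u + h *+ 2 - u) / 2 = h by field.
rewrite cosD sinD cos_mulr2n sin_mulr2n.
have := cos2Dsin2 u; have := cos2Dsin2 h.
set a := cos u; set b := sin u; set c := cos h; set d := sin h => hc hu.
have -> : c ^+ 2 *+ 2 - 1 = 1 - d ^+ 2 *+ 2 by rewrite -hc; ring.
transitivity (2 ^+ 2 * d ^+ 2 * ((a ^+ 2 + b ^+ 2) * (c ^+ 2 + d ^+ 2))); first by ring.
by rewrite hc hu !mulr1.
Qed.

(** Jordan's inequality. The difference [g] vanishes at both ends of the interval; if it were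
    negative at [t], the mean value theorem would give a negative slope before [t] and a positive
    one after it, although [cos] decreases. *)
Lemma sin_ge_chord t : 0 <= t <= pi / 2 -> 2 * t / pi <= sin t.
Proof.
have pi0 := pi_gt0 R.
case/andP; rewrite le_eqVlt => /predU1P[<-|t0]; first by rewrite sin0 mulr0 mul0r.
rewrite le_eqVlt => /predU1P[->|tp].
  rewrite sin_pihalf le_eqVlt; apply/orP; left; apply/eqP.
  by move: pi0; generalize (pi : R) => q q0; field; rewrite gt_eqF.
pose g u : R := sin u - 2 / pi * u.
have dg (u : R) : is_derive u 1 g (cos u - 2 / pi).
  rewrite /g; apply: is_deriveB.
  have := is_deriveZ (2 / pi) (is_derive_id u (1 : R)).
  by rewrite /GRing.scale /= mulr1.
have cg a b : {within `[a, b], continuous g}.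
  apply: continuous_subspaceT => u.
  by apply/differentiable_continuous/derivable1_diffP.
have g0 : g 0 = 0 by rewrite /g sin0 mulr0 subr0.
have g1 : g (pi / 2) = 0.
  rewrite /g sin_pihalf; move: (pi0); generalize (pi : R) => q q0.
  by field; rewrite gt_eqF.
rewrite leNgt; apply/negP => tlt.
have gt0 : g t < 0 by rewrite /g subr_lt0; apply: lt_le_trans tlt _; rewrite mulrAC.
have [a + ga] := MVT t0 (fun x _ => dg x) (cg 0 t).
have [b + gb] := MVT tp (fun x _ => dg x) (cg t (pi / 2)).
rewrite !in_itv/= => /andP[tb bp] /andP[a0 at_].
have ca : cos a - 2 / pi < 0.
  by rewrite -(pmulr_llt0 _ (_ : 0 < t - 0)) ?subr0// -[X in _ * X](subr0 t) -ga g0 subr0.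
have cb : 0 < cos b - 2 / pi.
  by rewrite -(pmulr_lgt0 _ (_ : 0 < pi / 2 - t)) ?subr_gt0// -gb g1 sub0r oppr_gt0.
have : cos b < cos a.
  rewrite ltr_cos ?in_itv/=; lra.
lra.
Qed.

Lemma expi_inj t u : 0 <= t < pi *+ 2 -> 0 <= u < pi *+ 2 -> expi t = expi u -> t = u.
Proof.
wlog tu : t u / u <= t.
  move=> W ht hu e; have [|/ltW] := leP u t; first by move=> ut; exact: W.
  by move=> tu; apply/esym; exact: W.
move=> /andP[t0 tp] /andP[u0 up] /eqP; rewrite -subr_eq0 -normc_eq0 normc_expiB.
rewrite mulf_eq0 pnatr_eq0/= normr_eq0; move: tu; rewrite le_eqVlt => /predU1P[->//|ut].
by rewrite gt_eqF// sin_gt0_pi//; lra.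
Qed.

Lemma normc_expiB_ge t u : `|t - u| <= pi -> 2 * `|t - u| / pi <= normc (expi t - expi u).
Proof.
wlog tu : t u / u <= t.
  move=> W; have [|/ltW tu h] := leP u t; first exact: W.
  rewrite distrC -(opprB (expi u)) normcN; apply: W => //.
  by rewrite distrC.
rewrite normc_expiB ger0_norm ?subr_ge0// => h.
have := @sin_ge_chord ((t - u) / 2).
have -> : 2 * (t - u) / pi = 2 * (2 * ((t - u) / 2) / pi).
  by rewrite [2 * ((t - u) / 2)]mulrC divfK// mulrA.
move=> W; rewrite ler_pM2l//; apply: le_trans (W _) (ler_norm _).
by lra.
Qed.

(** Multiplication by [expi t] mixes real and imaginary parts, hence the joint induction. *)
Lemma continuous_horner_expi (p : {poly R[i]}) :
  continuous (fun t => complex.Re p.[expi t]) /\ continuous (fun t => complex.Im p.[expi t]).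
Proof.
elim/poly_ind: p => [|p c [IHr IHi]].
  by split => t; under [X in continuous_at _ X]eq_fun do rewrite horner0 /=; exact: cst_continuous.
have cc := @continuous_cos R; have cs := @continuous_sin R.
split.
- have -> : (fun t => complex.Re (p * 'X + c%:P).[expi t]) = (fun t =>
      complex.Re p.[expi t] * cos t - complex.Im p.[expi t] * sin t + complex.Re c).
    by apply/funext => u; rewrite hornerMXaddC; case: (p.[_]) => a b; case: c.
  move=> t; apply: cvgD; last exact: cvg_cst.
  by apply: cvgB; apply: cvgM; do ?[exact: IHr|exact: IHi|exact: cc|exact: cs].
- have -> : (fun t => complex.Im (p * 'X + c%:P).[expi t]) = (fun t =>
      complex.Re p.[expi t] * sin t + complex.Im p.[expi t] * cos t + complex.Im c).
    by apply/funext => u; rewrite hornerMXaddC; case: (p.[_]) => a b; case: c.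
  move=> t; apply: cvgD; last exact: cvg_cst.
  by apply: cvgD; apply: cvgM; do ?[exact: IHr|exact: IHi|exact: cc|exact: cs].
Qed.

Lemma continuous_normc_horner (p : {poly R[i]}) :
  continuous (fun t => normc p.[expi t] ^+ 2).
Proof.
have [cr ci] := continuous_horner_expi p.
have -> : (fun t => normc p.[expi t] ^+ 2) = (fun t =>
    complex.Re p.[expi t] * complex.Re p.[expi t] +
    complex.Im p.[expi t] * complex.Im p.[expi t]).
  by apply/funext => u; rewrite normc_sqr !expr2.
by move=> t; apply: cvgD; apply: cvgM; do ?[exact: cr|exact: ci].
Qed.

(** The strict inequalities put [t] in the open interval, so crossings found in different gaps are
    different. *)
Lemma normc_horner_IVT (p : {poly R[i]}) (c a b : R) : a < b -> 0 <= c ->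
    (normc p.[expi a] < c) && (c < normc p.[expi b]) ||
    (normc p.[expi b] < c) && (c < normc p.[expi a]) ->
  exists2 t, a < t < b & normc p.[expi t] = c.
Proof.
move=> ab c0 h.
have sq (u v : R) : 0 <= u -> 0 <= v -> u < v -> u ^+ 2 < v ^+ 2.
  by move=> u0 v0 uv; rewrite ltrXn2r.
pose g t := normc p.[expi t] ^+ 2.
have gc : {within `[a, b], continuous g}.
  by apply: continuous_subspaceT; exact: continuous_normc_horner.
have [|t] := @IVT R g a b (c ^+ 2) (ltW ab) gc.
  rewrite /g ge_min le_max.
  by case/orP: h => /andP[h1 h2]; apply/andP; split; apply/orP; [left|right|right|left];
    apply/ltW/sq => //; exact: normc_ge0.
rewrite in_itv/= => /andP[at_ tb] gt.
have ht : normc p.[expi t] = c.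
  by apply/eqP; rewrite -(@eqrXn2 _ 2) ?normc_ge0//; apply/eqP.
exists t => //; rewrite !lt_neqAle at_ tb !andbT; apply/andP; split; apply/eqP => e; subst t.
- by move: h; rewrite ht ltxx/= andbF.
- by move: h; rewrite ht ltxx/= andbF.
Qed.

(* On the unit circle the conjugate of [p] is a polynomial divided by ['X^m], so
   [|p| = c] becomes a polynomial equation of degree [2m]. *)
Lemma size_level_set_le (p : {poly R[i]}) (m : nat) (c : R) (zs : seq R[i]) :
  (size p <= m.+1)%N -> normc p.[1] != c -> 0 <= c -> uniq zs ->
  {in zs, forall z, normc z = 1 /\ normc p.[z] = c} ->
  (size zs <= m.*2)%N.
Proof.
move=> sp p1 c0 uz hz.
pose r : {poly R[i]} := \poly_(k < m.+1) (p`_(m - k))^*.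
pose q := p * r - (c ^+ 2)%:C%C *: 'X^m.
have rE z : normc z = 1 -> r.[z] = z ^+ m * (p.[z])^*.
  move=> z1; have zz : z * z^* = 1 by rewrite -normCK normcE z1 expr1n.
  rewrite horner_poly (horner_coef_wide _ sp) rmorph_sum/= mulr_sumr.
  rewrite (reindex_inj rev_ord_inj)/=; apply: eq_bigr => i _.
  rewrite subSS subKn -1?ltnS// rmorphM rmorphXn/= mulrCA; congr (_ * _).
  have im : (i <= m)%N by rewrite -ltnS.
  by rewrite -[X in z ^+ X * _](subnK im) exprD -mulrA -exprMn zz expr1n mulr1.
have qE z : normc z = 1 -> q.[z] = z ^+ m * (normc p.[z] ^+ 2 - c ^+ 2)%:C%C.
  move=> z1; rewrite hornerD hornerN hornerM rE// hornerZ hornerXn.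
  rewrite mulrCA -normCK normcE -rmorphXn [in RHS]rmorphB mulrBr/=; congr (_ - _).
  by rewrite mulrC.
(* At 1 the value of [q] is |p(1)|^2 - c^2, which is nonzero because [p] is off the level there. *)
have q0 : q != 0.
  apply/eqP => q0; move: (qE 1 (ComplexField.Normc.normc1 _)); rewrite q0 horner0 expr1n mul1r.
  move=> /esym/(congr1 (@complex.Re R))/=/eqP.
  by rewrite subr_eq0 eqrXn2 ?normc_ge0// (negPf p1).
rewrite -ltnS; apply: leq_trans (max_poly_roots q0 _ uz) _.
  apply/allP => z /hz[z1 pz]; by rewrite /root qE// pz subrr rmorph0 mulr0.
apply: leq_trans (size_polyD _ _) _; rewrite size_polyN geq_max; apply/andP; split.
  apply: leq_trans (size_polyMleq p r) _.
  have := leq_add sp (size_poly m.+1 (fun k => (p`_(m - k))^*)); rewrite -/r.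
  by move: (size p + size r)%N => k; lia.
apply: leq_trans (size_scale_leq _ _) _; rewrite size_polyXn; lia.
Qed.

End UnitCircle.

Arguments expi {R} t.

(** * Discrete estimates *)

Section Discrete.
Variable R : realType.
Implicit Types (z : R[i]) (t : R).

(* Each step kills one frequency: [v (j+1) - w_i v j] no longer contains [w_i]. *)
Lemma turan_max_ge (I : Type) (r : seq I) (k : I) (w a : I -> R[i]) (c : R) (m : nat) :
  (forall i, normc (w i) = 1) ->
  (forall j, (m <= j <= m + size r)%N ->
     normc (\sum_(i <- k :: r) a i * w i ^+ j) < c) ->
  normc (a k) * \prod_(i <- r) normc (w k - w i) < 2 ^+ size r * c.
Proof.
move=> w1; elim: r a c => [|i0 r IH] a c h.
  have := h m; rewrite addn0 leqnn => /(_ isT).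
  rewrite !big_cons !big_nil addr0 ComplexField.Normc.normcM normcX w1 expr1n.
  by rewrite !mulr1 expr0 mul1r.
rewrite big_cons /= mulrA -ComplexField.Normc.normcM exprSr -mulrA.
(* The differenced sum has coefficients a_i (w_i - w_i0) and is below c + c, which accounts for one
   factor 2 per step. *)
apply: (IH (fun i => a i * (w i - w i0))) => j /andP[mj jm].
have h0 := h j; have h1 := h j.+1.
have -> : \sum_(i <- k :: r) a i * (w i - w i0) * w i ^+ j =
  \sum_(i <- k :: i0 :: r) a i * w i ^+ j.+1 +
    - (w i0 * \sum_(i <- k :: i0 :: r) a i * w i ^+ j).
  rewrite mulr_sumr -sumrB !big_cons.
  rewrite [X in _ + (X + _)](_ : _ = 0) ?add0r; last by rewrite exprS; ring.
  congr (_ + _); first by rewrite exprS; ring.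
  by apply: eq_bigr => i _; rewrite exprS; ring.
apply: le_lt_trans (le_normcD _ _) _.
rewrite normcN ComplexField.Normc.normcM w1 mul1r mulrDl mul1r ltrD ?h0 ?h1 //=; lia.
Qed.

Lemma periodic_sum (g : nat -> nat) (N l : nat) :
  (forall j, g (j + N)%N = g j) ->
  (\sum_(j < N) g (j + l) = \sum_(j < N) g j)%N.
Proof.
move=> gN; elim: l => [|l IH]; first by under eq_bigr do rewrite addn0.
rewrite -IH; apply/eqP; rewrite -(eqn_add2l (g l)); apply/eqP.
have -> : (g l + \sum_(j < N) g (j + l.+1) = \sum_(j < N.+1) g (j + l))%N.
  by rewrite big_ord_recl/=; congr addn; apply: eq_bigr => i _; rewrite addnS.
by rewrite big_ord_recr/= [(N + l)%N]addnC gN addnC.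
Qed.

(** Double counting: each true index is followed by an exit (true to false) at distance less than
    [f], each exit serves at most [f] indices, and exits make up half of the transitions. *)
Lemma count_short_runs (e : nat -> bool) (N f : nat) :
  (forall j, e (j + N)%N = e j) ->
  (forall j, exists2 l, (l < f.+1)%N & ~~ e (j + l)%N) ->
  ((\sum_(j < N) e j).*2 <= f * \sum_(j < N) (e j != e j.+1))%N.
Proof.
move=> eN runs.
(* Over one period the sequence enters the true set as often as it leaves it. *)
have exits : (\sum_(j < N) (e j != e j.+1) = (\sum_(j < N) (e j && ~~ e j.+1)).*2)%N.
  have shift : (\sum_(j < N) e j.+1 = \sum_(j < N) e j)%N.
    rewrite -(@periodic_sum (fun j => e j : nat) N 1) => [|j]; last by rewrite eN.
    by apply: eq_bigr => i _; rewrite addn1.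
  have : (\sum_(j < N) (e j && ~~ e j.+1) + \sum_(j < N) e j.+1 =
          \sum_(j < N) (~~ e j && e j.+1) + \sum_(j < N) e j)%N.
    by rewrite -!big_split; apply: eq_bigr => i _ /=; case: (e i); case: (e i.+1).
  rewrite shift => /addIn; rewrite -addnn => {2}->; rewrite -big_split.
  by apply: eq_bigr => i _ /=; case: (e i); case: (e i.+1).
rewrite exits -doubleMr leq_double.
pose x j : nat := e j && ~~ e j.+1.
have xN j : x (j + N)%N = x j by rewrite /x -addSn !eN.
have -> : (f * \sum_(j < N) x j = \sum_(j < N) \sum_(l < f) x (j + l))%N.
  rewrite exchange_big; under eq_bigr do rewrite (periodic_sum _ _ _ xN).
  by rewrite sum_nat_const card_ord.
apply: leq_sum => j _; case ej : (e j) => //.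
have [l lf el] := runs j.
have : exists l, ~~ e (j + l)%N by exists l.
(* The first false index after [j] is [j + k.+1], so [j + k] is an exit. *)
move=> /ex_minnP[[|k]]; first by rewrite addn0 ej.
move=> ek mk; have kf : (k < f)%N by have := mk _ el; lia.
rewrite (bigD1 (Ordinal kf))//= /x addnS in ek *.
have -> : e (j + k)%N by apply/negPn/negP => /mk; rewrite ltnn.
by rewrite -addnS addnS ek.
Qed.

Lemma sum_expi_root (N d : nat) : (0 < N)%N -> (d < N)%N -> (0 < d)%N ->
  \sum_(j < N) expi (2 * pi / N%:R : R) ^+ (j * d) = 0.
Proof.
move=> N0 dN d0.
pose h : R := 2 * pi / N%:R; rewrite -/h.
have pi0 := pi_gt0 R.
have hN : h *+ N = pi *+ 2.
  by rewrite -mulr_natr /h divfK ?pnatr_eq0 -?lt0n// mulr_natl.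
have h0 : 0 < h by rewrite /h divr_gt0 ?mulr_gt0 ?ltr0n.
have w1 : expi h ^+ d != 1.
  apply/eqP; rewrite -expiMn -(expi0 R) => /(@expi_inj R) H.
  have : h *+ d = 0.
    apply: H; last by rewrite lexx mulrn_wgt0.
    by rewrite mulrn_wge0 ?(ltW h0)// -hN ltr_pMn2l.
  by apply/eqP; rewrite gt_eqF// mulrn_wgt0.
have : (expi h ^+ d - 1) * \sum_(j < N) (expi h ^+ d) ^+ j = 0.
  by rewrite -subrX1 -exprM mulnC exprM -expiMn hN expi2pi expr1n subrr.
move/eqP; rewrite mulf_eq0 subr_eq0 (negPf w1) /= => /eqP sum0; rewrite -[RHS]sum0.
by apply: eq_bigr => j _; rewrite mulnC exprM.
Qed.

(** Orthogonality of the characters: two distinct exponents below [N] are not congruent mod [N], so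
    the off-diagonal sums are geometric sums that vanish. *)
Lemma discrete_parseval (p : {poly R[i]}) (N : nat) : (size p <= N)%N ->
  \sum_(j < N) normc p.[expi (2 * pi / N%:R) ^+ j] ^+ 2 =
    N%:R * \sum_(m < N) normc p`_m ^+ 2.
Proof.
move=> sp; case: N sp => [|N] sp; first by rewrite !big_ord0 mulr0.
set w := expi _.
have w1 : w * w^* = 1 by rewrite -normCK normcE normc_expi expr1n.
apply: (@complexI R); rewrite rmorphM !rmorph_sum/= rmorph_nat.
under eq_bigr do rewrite rmorphXn/= -normcE normCK (horner_coef_wide _ sp) rmorph_sum/=
  big_distrlr/=.
rewrite exchange_big/= mulr_sumr; apply: eq_bigr => a _.
rewrite exchange_big/= (bigD1 a)//= [X in _ + X]big1 ?addr0 => [|b ba].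
  under eq_bigr => j _.
    rewrite rmorphM rmorphXn/= mulrACA -exprMn rmorphXn/= -exprMn w1 !expr1n mulr1.
    over.
  by rewrite sumr_const card_ord -normCK normcE rmorphXn mulr_natl.
under eq_bigr do rewrite rmorphM/= mulrACA.
rewrite -mulr_sumr.
have key (x y : nat) : (x < y < N.+1)%N ->
    \sum_(j < N.+1) ((w ^+ j) ^+ x)^* * (w ^+ j) ^+ y = 0.
  move=> /andP[xy yN]; rewrite -[RHS](@sum_expi_root N.+1 (y - x)) ?subn_gt0//; last first.
    by apply: leq_ltn_trans (leq_subr _ _) yN.
  apply: eq_bigr => j _; rewrite -[in LHS](subnKC (ltnW xy)) exprD mulrA.
  by rewrite rmorphXn -exprMn rmorphXn/= -exprMn mulrC [_^* * _]mulrC w1 !expr1n mulr1 exprM.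
(* [key] covers one order of the exponents; the other follows by conjugating the sum. *)
have [ab|ba'|ab] := ltngtP a b; last by rewrite -val_eqE /= ab eqxx in ba.
  apply/eqP; rewrite mulf_eq0 -[X in _ || X]conjC_eq0 rmorph_sum/=; apply/orP; right.
  apply/eqP; rewrite -[RHS](key a b) ?ab ?ltn_ord//.
  apply: eq_bigr => j _; by rewrite rmorphM; congr (_ * _); exact: conjCK.
rewrite [X in _ * X](_ : _ = 0) ?mulr0// -[RHS](key b a) ?ba' ?ltn_ord//.
by apply: eq_bigr => j _; rewrite mulrC.
Qed.

(** Cauchy-Schwarz against the constant 1, obtained by summing 2 g_i g_j <= g_i^2 + g_j^2 over all
    pairs. *)
Lemma sum_sqr_le (I : finType) (A : pred I) (g : I -> R) :
  (\sum_(i | A i) g i) ^+ 2 <= #|A|%:R * \sum_(i | A i) g i ^+ 2.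
Proof.
set S := \sum_(i | A i) g i; set Q := \sum_(i | A i) g i ^+ 2.
have SE : \sum_(i | A i) \sum_(j | A j) (2 * (g i * g j)) = 2 * S ^+ 2.
  rewrite expr2 big_distrlr/= mulr_sumr; apply: eq_bigr => i _.
  by rewrite mulr_sumr.
have QE : \sum_(i | A i) \sum_(j | A j) (g i ^+ 2 + g j ^+ 2) = 2 * (#|A|%:R * Q).
  under eq_bigr do rewrite big_split/= sumr_const -/Q.
  rewrite big_split/= sumr_const -mulr_natl sumrMnl -/Q -[Q *+ _]mulr_natl; ring.
have : 2 * S ^+ 2 <= 2 * (#|A|%:R * Q).
  rewrite -SE -QE; apply: ler_sum => i _; apply: ler_sum => j _.
  by have := sqr_ge0 (g i - g j); rewrite sqrrB; lra.
by rewrite ler_pM2l.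
Qed.

End Discrete.

(** * Lower bound for the product of two sparse polynomials *)

Section SparseProduct.
Variable R : realType.
Implicit Types (z : R[i]) (t : R) (p q : {poly R[i]}).

Lemma normc_sum_le (I : Type) (r : seq I) (P : pred I) (F : I -> R[i]) :
  normc (\sum_(i <- r | P i) F i) <= \sum_(i <- r | P i) normc (F i).
Proof.
elim/big_rec2: _ => [|i x y _ h]; first by rewrite ComplexField.Normc.normc0.
by apply: le_trans (le_normcD _ _) _; rewrite lerD2l.
Qed.

(** Each transition forces a point with |p| = c strictly inside its own arc, and [size_level_set_le]
    bounds the number of such points. *)
Lemma transitions_le p (n N : nat) (eps : R) : (size p <= n.+1)%N -> (0 < N)%N -> 0 < eps ->
  (\sum_(j < N) ((normc p.[expi (2 * pi / N%:R) ^+ j] < eps)%R !=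
                 (normc p.[expi (2 * pi / N%:R) ^+ j.+1] < eps)%R) <= n.*2)%N.
Proof.
move=> sp N0 eps0; set h : R := 2 * pi / N%:R.
have pi0 := pi_gt0 R.
have h0 : 0 < h by rewrite /h divr_gt0 ?mulr_gt0 ?ltr0n.
have hN : h *+ N = pi *+ 2.
  by rewrite -mulr_natr /h divfK ?pnatr_eq0 -?lt0n// mulr_natl.
pose v j := normc p.[expi h ^+ j].
pose e j := v j < eps; rewrite -/(v _) -/(e _).
(* [M] is the largest sampled value below [eps] (0 if there is none), and [c] will be halfway from
   [M] to [eps]. No sample takes the value [c], so crossings are interior to the gaps and |p(1)|
   differs from [c]. The index [N] is included because the last gap ends there. *)
pose M := \big[Order.max/0]_(j < N.+1 | e j) v j.
have M0 : 0 <= M by rewrite /M; elim/big_ind: _ => [//|x y x0 y0|i _]; rewrite ?le_max ?x0// /v normc_ge0.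
have Meps : M < eps by apply: bigmax_lt.
pose c := (M + eps) / 2.
have c0 : 0 <= c by rewrite /c; lra.
have ec (j : nat) : (j <= N)%N -> e j -> v j < c.
  move=> jN ej; have : v j <= M.
    by rewrite /M; apply: (@le_bigmax_cond _ _ _ 0 (Ordinal (jN : (j < N.+1)%N))).
  by rewrite /c; lra.
have nec (j : nat) : ~~ e j -> c < v j by rewrite /e -leNgt /c; lra.
have vE (j : nat) : v j = normc p.[expi (h *+ j)] by rewrite expiMn.
have /choice[g hg] : forall j : 'I_N, exists t, e j != e j.+1 ->
    h *+ j < t < h *+ j.+1 /\ normc p.[expi t] = c.
  move=> j; have [|ne] := eqVneq (e j) (e j.+1); first by exists 0.
  have [|||t ht tc] := @normc_horner_IVT R p c (h *+ j) (h *+ j.+1).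
  - by rewrite ltr_pMn2l.
  - exact: c0.
  - rewrite -!vE; case: (boolP (e j)) ne => ej; case: (boolP (e j.+1)) => ej1 //= _.
      by rewrite (ec j (ltnW (ltn_ord j)) ej) (nec _ ej1).
    by rewrite (ec j.+1 (ltn_ord j) ej1) (nec _ ej) orbT.
  by exists t.
pose A := [pred j : 'I_N | e j != e j.+1].
rewrite -(_ : size [seq expi (g j) | j <- enum A] =
  \sum_(j < N) (e j != e j.+1))%N; last first.
  by rewrite size_map -cardE -sum1_card big_mkcond; apply: eq_bigr => j _.
have gI (j : 'I_N) : j \in A -> 0 <= g j < pi *+ 2.
  move=> /hg[/andP[g1 g2] _]; rewrite -hN; apply/andP; split.
    by apply: le_trans (ltW g1); rewrite mulrn_wge0// ltW.
  by apply: lt_le_trans g2 _; rewrite ler_pMn2l.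
have gmono (i j : 'I_N) : i \in A -> j \in A -> (i < j)%N -> g i < g j.
  move=> /hg[/andP[_ g1] _] /hg[/andP[g2 _] _] ij.
  by apply: lt_trans g1 _; apply: le_lt_trans g2; rewrite ler_pMn2l.
apply: (@size_level_set_le R p n c) => //.
- have v0 : v 0%N = normc p.[1] by rewrite /v expr0.
  rewrite -v0; have [/(ec _ (leq0n _)) h1|/nec h1] := boolP (e 0%N).
    by rewrite lt_eqF.
  by rewrite gt_eqF.
- rewrite map_inj_in_uniq ?enum_uniq// => i j; rewrite !mem_enum => iA jA gij.
  have {}gij := @expi_inj R _ _ (gI _ iA) (gI _ jA) gij.
  apply: ord_inj; have [ij|ij|//] := ltngtP (i : nat) j.
    by have := gmono _ _ iA jA ij; rewrite gij ltxx.
  by have := gmono _ _ jA iA ij; rewrite gij ltxx.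
- move=> z /mapP[j]; rewrite mem_enum => /hg[_ gj] ->; split=> //.
  exact: normc_expi.
Qed.

(** Cauchy-Schwarz over the support only, so the factor is the sparsity and not the length. *)
Lemma normc_horner_sqr_le p (n : nat) z : (size p <= n)%N -> normc z = 1 ->
  normc p.[z] ^+ 2 <= #|[pred i : 'I_n | p`_i != 0]|%:R * \sum_(i < n) normc p`_i ^+ 2.
Proof.
move=> sp z1; set A := [pred i : 'I_n | _].
have supp (F : 'I_n -> R) : (forall i : 'I_n, p`_i = 0 -> F i = 0) ->
    \sum_i F i = \sum_(i | A i) F i.
  by move=> F0; rewrite [RHS]big_mkcond; apply: eq_bigr => i _ /=; case: eqP => // /F0.
rewrite (supp (fun i => normc p`_i ^+ 2)); last first.
  by move=> i ->; rewrite ComplexField.Normc.normc0 expr0n.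
apply: le_trans (@sum_sqr_le R _ A (fun i => normc p`_i)).
rewrite lerXn2r ?nnegrE ?normc_ge0//; first by rewrite sumr_ge0// => i _; exact: normc_ge0.
rewrite -supp => [|i ->]; last exact: ComplexField.Normc.normc0.
rewrite (horner_coef_wide _ sp); apply: le_trans (normc_sum_le _ _ _ _) _.
by apply: ler_sum => i _; rewrite ComplexField.Normc.normcM normcX z1 expr1n mulr1.
Qed.

(** Since 2m <= N, the two angles differ by at most pi, and by at least 2 pi / N; the chord bound
    [normc_expiB_ge] then gives 2 (2 pi / N) / pi. *)
Lemma chord_root_ge (N m a b : nat) : (0 < N)%N -> (m.*2 <= N)%N ->
  (a <= m)%N -> (b <= m)%N -> a != b ->
  4 / N%:R <= normc (expi (2 * pi / N%:R : R) ^+ a - expi (2 * pi / N%:R) ^+ b).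
Proof.
move=> N0 mN; wlog ba : a b / (b < a)%N.
  move=> W am bm ab; have [ba|ab'|e] := ltngtP b a.
  - exact: W.
  - by rewrite -normcN opprB; apply: W => //; rewrite eq_sym.
  - by rewrite e eqxx in ab.
move=> am bm _; set h : R := 2 * pi / N%:R.
have pi0 := pi_gt0 R.
have N0R : 0 < N%:R :> R by rewrite ltr0n.
have h0 : 0 < h by rewrite /h divr_gt0 ?mulr_gt0.
have dE : h *+ a - h *+ b = h *+ (a - b) by rewrite mulrnBr// ltnW.
have dabs : `|h *+ a - h *+ b| = h *+ (a - b) by rewrite dE ger0_norm// mulrn_wge0// ltW.
rewrite -!expiMn; apply: le_trans (normc_expiB_ge _ _ _ _); rewrite dabs.
  have -> : 4 / N%:R = 2 * h / pi.
    by rewrite /h; move: (pi0); generalize (pi : R) => x x0; field; rewrite !gt_eqF.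
  rewrite ler_pM2r ?invr_gt0// ler_pM2l// -[leLHS]mulr1n ler_pMn2l// subn_gt0//.
rewrite -(@ler_pMn2r _ N)// -mulrnA mulnC mulrnA.
have -> : h *+ N = pi *+ 2 by rewrite -mulr_natr /h divfK ?gt_eqF// mulr_natl.
rewrite -mulrnA ler_pMn2l// mul2n; apply: leq_trans mN; rewrite leq_double; lia.
Qed.

(** The largest coefficient q_k is at least S / (f+1). If the whole run were small, [turan_max_ge]
    with nodes at least 4 / N apart would make q_k smaller than that. *)
Lemma no_long_small_run q (m f N j : nat) : (size q <= m.+1)%N ->
  (#|[pred i : 'I_m.+1 | (q`_i != 0)%R]| <= f.+1)%N -> (m.*2 <= N)%N -> (2 <= N)%N ->
  0 < \sum_(i < m.+1) normc q`_i ->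
  exists2 l, (l < f.+1)%N &
    f.+1%:R^-1 * (2 / N%:R) ^+ f * \sum_(i < m.+1) normc q`_i
      <= normc q.[expi (2 * pi / N%:R) ^+ (j + l)].
Proof.
move=> sq; set A := [pred i : 'I_m.+1 | _] => Af mN N2 q0.
set S := \sum_(i < _) _ in q0 *.
set w := expi _; set eps := _ * S.
have [[l lf le]|H] := pselect (exists2 l, (l < f.+1)%N & eps <= normc q.[w ^+ (j + l)]).
  by exists l.
exfalso.
have {}H l : (l < f.+1)%N -> normc q.[w ^+ (j + l)] < eps.
  by move=> lf; rewrite ltNge; apply/negP => hl; apply: H; exists l.
have N0R : 0 < N%:R :> R by rewrite ltr0n; lia.
have [k _ kmax] := @arg_maxP _ _ _ (ord0 : 'I_m.+1) predT (fun i : 'I_m.+1 => normc q`_i) isT.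
have supp (V : nmodType) (F : 'I_m.+1 -> V) : (forall i : 'I_m.+1, q`_i = 0 -> F i = 0) ->
    \sum_i F i = \sum_(i | A i) F i.
  by move=> F0; rewrite [RHS]big_mkcond; apply: eq_bigr => i _ /=; case: eqP => // /F0.
have Sle : S <= f.+1%:R * normc q`_k.
  rewrite /S supp => [|i ->]; last exact: ComplexField.Normc.normc0.
  apply: (@le_trans _ _ (\sum_(i | A i) normc q`_k)); first by apply: ler_sum => i _; exact: kmax.
  by rewrite sumr_const -[leLHS]mulr_natl ler_wpM2r ?normc_ge0// ler_nat.
have kA : A k.
  apply/negP => /eqP qk0; move: Sle; rewrite qk0 ComplexField.Normc.normc0 mulr0.
  by rewrite leNgt q0.
pose r := enum [predD1 A & k].
have rf : (size r <= f)%N.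
  by rewrite -cardE -ltnS; apply: leq_trans Af; rewrite (cardD1 k A) (kA : k \in A).
have sumr (F : 'I_m.+1 -> R[i]) : (forall i : 'I_m.+1, q`_i = 0 -> F i = 0) ->
    \sum_i F i = \sum_(i <- k :: r) F i.
  move=> F0; rewrite supp// (bigD1 k)//= big_cons big_enum/=; congr (_ + _).
  by apply: eq_bigl => i; rewrite !inE andbC.
have w1 : normc w = 1 by exact: normc_expi.
have wi (i : 'I_m.+1) : normc (w ^+ i) = 1 by rewrite normcX w1 expr1n.
(* Frequency and time are exchanged: q(w^l) is the sum of q_i (w^i)^l, an exponential sum in [l]
   with unimodular nodes w^i. *)
have vle l : (j <= l <= j + size r)%N ->
    normc (\sum_(i <- k :: r) q`_i * (w ^+ i) ^+ l) < eps.
  move=> /andP[jl ljr].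
  rewrite -sumr => [|i ->]; last by rewrite mul0r.
  rewrite (_ : \sum_i _ = q.[w ^+ (j + (l - j))]); first by apply: H; lia.
  rewrite subnKC// (horner_coef_wide _ sq); apply: eq_bigr => i _.
  by rewrite -!exprM mulnC.
have := @turan_max_ge R _ r k (fun i : 'I_m.+1 => w ^+ i) (fun i => q`_i) eps j wi vle.
apply/negP; rewrite -leNgt.
have P : (4 / N%:R) ^+ size r <= \prod_(i <- r) normc (w ^+ k - w ^+ i).
  rewrite -[X in _ ^+ X]count_predT -iter_mulr_1 -big_const_seq.
  rewrite big_seq [leRHS]big_seq; apply: ler_prod => i; rewrite mem_enum => /andP[ik _].
  rewrite divr_ge0 ?ler0n//=; apply: (@chord_root_ge N m) => //; first by lia.
  - by rewrite -ltnS.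
  - by rewrite -ltnS.
  - by rewrite eq_sym val_eqE.
have N2R : 0 <= 2 / N%:R :> R by rewrite divr_ge0.
apply: le_trans (ler_wpM2l (normc_ge0 _ _) P).
(* One factor 2 per node cancels the 2^(size r) of [turan_max_ge]; then [size r <= f] and 2 / N <= 1
   allow the exponent [f]. *)
have -> : 4 / N%:R = 2 * (2 / N%:R) :> R by rewrite mulrA -natrM.
rewrite exprMn [leRHS]mulrCA ler_pM2l ?exprn_gt0//.
apply: (@le_trans _ _ ((2 / N%:R) ^+ f * normc q`_k)).
  by rewrite /eps mulrAC mulrC ler_wpM2l ?exprn_ge0// ler_pdivrMl ?ltr0n.
rewrite mulrC ler_wpM2l ?normc_ge0//; apply: ler_wiXn2l => //.
by rewrite ler_pdivrMr// mul1r ler_nat.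
Qed.

Theorem sparse_product_ge p q (m s f N : nat) :
  (size p <= m.+1)%N -> (size q <= m.+1)%N ->
  (#|[pred i : 'I_m.+1 | (p`_i != 0)%R]| <= s)%N ->
  (#|[pred i : 'I_m.+1 | (q`_i != 0)%R]| <= f.+1)%N ->
  (m.*2 < N)%N -> (2 <= N)%N ->
  (f.+1%:R^-1 * (2 / N%:R) ^+ f) ^+ 2 * (1 - (s * m * f)%:R / N%:R) *
    (\sum_(i < m.+1) normc p`_i ^+ 2) * (\sum_(i < m.+1) normc q`_i) ^+ 2
  <= \sum_(k < N) normc (p * q)`_k ^+ 2.
Proof.
move=> sp sq As Af mN N2.
have N0 : (0 < N)%N by lia.
have N0R : 0 < N%:R :> R by rewrite ltr0n.
have sumN (F : 'I_m.+1 -> R) : (forall i, 0 <= F i) -> 0 <= \sum_i F i.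
  by move=> F0; apply: sumr_ge0 => i _.
have S0 : 0 <= \sum_(i < m.+1) normc q`_i by apply: sumN => i; exact: normc_ge0.
have X0 : 0 <= \sum_(i < m.+1) normc p`_i ^+ 2 by apply: sumN => i; exact: sqr_ge0.
have RHS0 : 0 <= \sum_(k < N) normc (p * q)`_k ^+ 2.
  by apply: sumr_ge0 => i _; exact: sqr_ge0.
set S : R := \sum_(i < _) normc q`_i in S0 *.
(* For q = 0 the left side vanishes; otherwise the threshold [eps] is positive. *)
have [S1|{}S0] := leP S 0.
  have -> : S = 0 by apply/le_anti; rewrite S1 S0.
  by rewrite expr0n/= mulr0.
set X := \sum_(i < _) _ in X0 *.
pose eps := f.+1%:R^-1 * (2 / N%:R) ^+ f * S.
have eps0 : 0 < eps.
  by rewrite /eps !mulr_gt0 ?exprn_gt0 ?divr_gt0 ?invr_gt0 ?ltr0n.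
pose w : R[i] := expi (2 * pi / N%:R).
have wN : w ^+ N = 1.
  rewrite /w -expiMn (_ : _ *+ N = pi *+ 2) ?expi2pi//.
  by rewrite -[LHS]mulr_natr divfK ?gt_eqF// mulr_natl.
have w1 (j : nat) : normc (w ^+ j) = 1 by rewrite normcX normc_expi expr1n.
pose e j := normc q.[w ^+ j] < eps.
have eN j : e (j + N)%N = e j by rewrite /e exprD wN mulr1.
(* Twice the count is at most [f] times the number of transitions, which is at most 2m. *)
have card_e : (\sum_(j < N) e j <= m * f)%N.
  have runs j : exists2 l, (l < f.+1)%N & ~~ e (j + l)%N.
    have [|l lf hl] := @no_long_small_run q m f N j sq Af _ N2 S0; first exact: ltnW.
    by exists l => //; rewrite /e -leNgt.
  have := @count_short_runs e N f eN runs.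
  have := @transitions_le q m N eps sq N0 eps0; rewrite -/w => tr.
  move=> h; rewrite -leq_double; apply: leq_trans h _.
  by rewrite mulnC doubleMl leq_mul2r tr orbT.
have Xle j : normc p.[w ^+ j] ^+ 2 <= s%:R * X.
  apply: le_trans (normc_horner_sqr_le _ _ _ sp (w1 j)) _.
  by rewrite ler_wpM2r// ler_nat.
have PX : \sum_(j < N) normc p.[w ^+ j] ^+ 2 = N%:R * X.
  rewrite discrete_parseval; last by lia.
  congr (_ * _); rewrite /X -(big_mkord xpredT (fun i => normc p`_i ^+ 2)).
  rewrite -(big_mkord xpredT (fun i => normc p`_i ^+ 2)).
  rewrite (@big_cat_nat _ _ _ m.+1)//=; last by lia.
  rewrite [X in _ + X]big_nat_cond [X in _ + X]big1 ?addr0// => i /andP[/andP[mi _] _].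
  by rewrite nth_default ?ComplexField.Normc.normc0 ?expr0n//; exact: leq_trans mi.
have := @discrete_parseval R (p * q) N _; rewrite -/w => PZ.
rewrite -(ler_pM2l N0R) -PZ; last first.
  apply: leq_trans (size_polyMleq _ _) _.
  by have := leq_add sp sq; move: (size p + size q)%N => k; lia.
(* N X is the total of |p|^2 over the samples and s X bounds each single sample, so the bracket
   bounds from below the part of the total where [e] is false. *)
apply: (@le_trans _ _ (eps ^+ 2 * (N%:R * X - (\sum_(j < N) e j)%:R * (s%:R * X)))).
  rewrite [leLHS](_ : _ = eps ^+ 2 * (N%:R * X - (m * f)%:R * (s%:R * X))); last first.
    rewrite /eps -mulnA natrM; move: (f.+1%:R^-1 * _) (m * f)%N => a b.
    by field; rewrite gt_eqF.
  rewrite ler_wpM2l ?sqr_ge0// lerD2l lerN2 ler_wpM2r ?mulr_ge0// ler_nat//.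
(* Termwise: where [e] holds the left term is at most 0, elsewhere |q|^2 >= eps^2. *)
rewrite -PX natr_sum mulr_suml -sumrB mulr_sumr; apply: ler_sum => j _.
rewrite hornerM ComplexField.Normc.normcM [leRHS]exprMn [leRHS]mulrC.
have [ej|] := boolP (e j).
  apply: (@le_trans _ _ 0); last by rewrite mulr_ge0 ?sqr_ge0.
  by rewrite mul1r mulr_ge0_le0 ?sqr_ge0// subr_le0.
rewrite /e -leNgt => ej; rewrite mul0r subr0 ler_wpM2r ?sqr_ge0//.
by rewrite lerXn2r ?nnegrE ?normc_ge0 ?(ltW eps0).
Qed.

End SparseProduct.

(** * Norms of sequences on the integers *)

Section IntegerNorms.
Variable R : realType.
Implicit Types (z : R[i]) (t : R) (p q : {poly R[i]}).

Lemma fsbig_Posz (V : Type) (idx : V) (op : Monoid.com_law idx) (n : nat) (a : int -> V) :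
  \big[op/idx]_(g \in [set Posz k | k in `I_n]) a g = \big[op/idx]_(k < n) a (Posz k).
Proof.
rewrite fsbig_image; first by rewrite (fsbig_ord op n (fun k => a (Posz k))).
by move=> i j _ _ [].
Qed.

Lemma esum_int_ge (a : int -> R) (n : nat) :
  ((\sum_(k < n) a (Posz k))%:E <= \esum_(g in [set: int]) (a g)%:E)%E.
Proof.
apply: esum_ge; exists [set Posz k | k in `I_n].
  by split=> //; exact: finite_image.
by rewrite fsbig_Posz sumEFin.
Qed.

Lemma esum_int_ord (a : int -> R) (n : nat) : (forall g, 0 <= a g) ->
  (forall g, ~ [set Posz k | k in `I_n] g -> a g = 0) ->
  \esum_(g in [set: int]) (a g)%:E = (\sum_(k < n) a (Posz k))%:E.
Proof.
move=> a0 az; rewrite (esumID [set Posz k | k in `I_n]) => [|g _]; last by rewrite lee_fin.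
rewrite !setTI [X in (_ + X)%E]esum1 ?adde0 => [|g /az ->//].
rewrite esum_fset ?fsbig_Posz ?sumEFin//; first exact: finite_image.
by move=> g _; rewrite lee_fin.
Qed.

Lemma extZ_Posz (n : nat) (x : 'rV[R[i]]_n) (k : nat) : extZ x (Posz k) = (rVpoly x)`_k.
Proof. by rewrite coef_rVpoly /=; case: insub. Qed.

Lemma lpnorm_extZ (r : R) (n : nat) (x : 'rV[R[i]]_n) : r != 0 ->
  lpnorm r (extZ x) = ((\sum_(i < n) normc (rVpoly x)`_i `^ r) `^ r^-1)%:E.
Proof.
move=> r0; rewrite /lpnorm (@esum_int_ord (fun g => normc (extZ x g) `^ r) n).
- by rewrite poweR_EFin; under eq_bigr do rewrite extZ_Posz.
- by move=> g; exact: powR_ge0.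
(* As 0 to the power 0 is 1, the terms outside the support vanish only for a nonzero exponent. *)
- move=> g gn; rewrite (_ : extZ x g = 0) ?ComplexField.Normc.normc0 ?powR0//.
  case: g gn => [k|k] gk //=; case: insubP => //= i ki _.
  by exfalso; apply: gk; exists k.
Qed.

Lemma convolution_Posz (n : nat) (x y : 'rV[R[i]]_n) (k : nat) :
  convolution (extZ x) (extZ y) (Posz k) = (rVpoly x * rVpoly y)`_k.
Proof.
(* A negative h kills the first factor, and h > k makes k - h negative and kills the second. *)
rewrite /convolution -(fsbig_widen [set Posz j | j in `I_k.+1]) //.
  rewrite fsbig_Posz coefM; apply: eq_bigr => j _.
  have jk : (j <= k)%N by rewrite -ltnS.
  by rewrite subzn// !extZ_Posz.
move=> [j|j] [_ jk] /=; last by rewrite mul0r.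
have kj : (k < j)%N by rewrite ltnNge; apply/negP => ?; apply: jk; exists j.
have -> : Posz k - Posz j = Negz (j - k).-1 by lia.
by rewrite mulr0.
Qed.

(** Any finite part of the sum is a lower bound, so the support of the convolution need not be
    determined. *)
Lemma lpnorm2_convolution_ge (n N : nat) (x y : 'rV[R[i]]_n) :
  ((Num.sqrt (\sum_(k < N) normc (rVpoly x * rVpoly y)`_k ^+ 2))%:E <=
   lpnorm 2 (convolution (extZ x) (extZ y)))%E.
Proof.
have S0 : 0 <= \sum_(k < N) normc (rVpoly x * rVpoly y)`_k ^+ 2.
  by apply: sumr_ge0 => k _; exact: sqr_ge0.
rewrite -powR12_sqrt// -poweR_EFin /lpnorm.
have ge : ((\sum_(k < N) normc (rVpoly x * rVpoly y)`_k ^+ 2)%:E <=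
    \esum_(g in [set: int]) (normc (convolution (extZ x) (extZ y) g) `^ 2)%:E)%E.
  apply: le_trans (esum_int_ge _ N); rewrite lee_fin; apply: ler_sum => k _.
  by rewrite convolution_Posz powR_mulrn ?normc_ge0.
apply: gt0_ler_poweR => //; rewrite in_itv/= leey andbT.
  by rewrite lee_fin.
by apply: le_trans ge; rewrite lee_fin.
Qed.

(** [N] and [alpha] stay free, since different ranges of the parameters call for different sampling
    rates. *)
Lemma sparse_convolution_ge (m s f N : nat) (alpha : R) :
  (m.*2 < N)%N -> (2 <= N)%N -> 0 <= alpha ->
  alpha ^+ 2 <= (f.+1%:R^-1 * (2 / N%:R) ^+ f) ^+ 2 * (1 - (s * m * f)%:R / N%:R) ->
  forall x y : 'rV[R[i]]_m.+1, Sigma R s m.+1 x -> Sigma R f.+1 m.+1 y ->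
  (alpha%:E * lpnorm 2 (extZ x) * lpnorm 1 (extZ y)
     <= lpnorm 2 (convolution (extZ x) (extZ y)))%E.
Proof.
move=> mN N2 a0 ale x y sx sy.
have supp (k : nat) (u : 'rV[R[i]]_m.+1) : Sigma R k m.+1 u ->
    (#|[pred i : 'I_m.+1 | ((rVpoly u)`_i != 0)%R]| <= k)%N.
  by apply: leq_trans; apply/eq_leq/eq_card => i; rewrite !inE coef_rVpoly_ord.
have sz (u : 'rV[R[i]]_m.+1) : (size (rVpoly u) <= m.+1)%N by exact: size_poly.
have := @sparse_product_ge R _ _ m s f N (sz x) (sz y) (supp _ _ sx) (supp _ _ sy) mN N2.
set X := \sum_(i < _) _ ^+ 2; set S := \sum_(i < m.+1) normc _; set Z := \sum_(k < N) _.
move=> le.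
have X0 : 0 <= X by apply: sumr_ge0 => k _; exact: sqr_ge0.
have S0 : 0 <= S by apply: sumr_ge0 => k _; exact: normc_ge0.
have Z0 : 0 <= Z by apply: sumr_ge0 => k _; exact: sqr_ge0.
apply: le_trans (lpnorm2_convolution_ge _ N x y).
rewrite !lpnorm_extZ ?oner_eq0 ?pnatr_eq0// invr1 -!EFinM lee_fin.
rewrite powRr1; last by apply: sumr_ge0 => k _; exact: powR_ge0.
under eq_bigr do rewrite powR_mulrn ?normc_ge0//.
under [X in _ * X]eq_bigr do rewrite powRr1 ?normc_ge0//.
rewrite powR12_sqrt// -/X -/S -/Z.
rewrite -(@ler_pXn2r _ 2)// ?nnegrE ?mulr_ge0 ?sqrtr_ge0//.
rewrite !exprMn !sqr_sqrtr//; apply: le_trans le.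
by rewrite ler_wpM2r ?sqr_ge0// ler_wpM2r.
Qed.

End IntegerNorms.

(** * Comparison of the constants *)

Section Constants.
Variable R : realType.

(** This is twice the logarithmic inequality left in [bound1_lt_generic] once the terms in ln s and
    ln n are dropped, with j + 2 the sparsity of y. *)
Lemma pow_ineq_bound1 (j : nat) :
  (2%:R : R) ^+ (4 * j ^ 2 + 14 * j + 7) * j.+1%:R ^+ (2 * j + 2) <
  j.+2%:R ^+ (2 * j ^ 2 + 8 * j + 9).
Proof.
case: j => [|[|[|[|j]]]]; [by lra|by lra|by lra|by lra|].
rewrite -!natrX -natrM ltr_nat; set k := j.+4.
have le1 : (k.+1 ^ (2 * k + 2) <= k.+2 ^ (2 * k + 2))%N by rewrite leq_exp2r//; lia.
(* Here k + 2 >= 6, and 2^5 <= 6^2. *)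
have le2 : (2 ^ (5 * (k ^ 2 + 3 * k + 3)) <= k.+2 ^ (2 * (k ^ 2 + 3 * k + 3)))%N.
  rewrite !expnM leq_exp2r//; last by lia.
have -> : (2 * k ^ 2 + 8 * k + 9 = (2 * k + 2) + 2 * (k ^ 2 + 3 * k + 3) + 1)%N by lia.
rewrite [ltnRHS]expnD expn1 [X in (_ < X * _)%N]expnD [ltnLHS]mulnC.
apply: (@leq_ltn_trans (k.+2 ^ (2 * k + 2) * k.+2 ^ (2 * (k ^ 2 + 3 * k + 3)))%N).
  apply: leq_mul; first exact: le1.
  apply: leq_trans le2; rewrite leq_exp2l//; nia.
by rewrite ltn_Pmulr// muln_gt0 !expn_gt0.
Qed.

Lemma pow_ineq_bound2 (j : nat) :
  (2%:R : R) ^+ (4 * j ^ 2 + 22 * j + 33) * j.+2%:R ^+ (2 * j + 4) <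
  j.+3%:R ^+ (4 * j ^ 2 + 20 * j + 26).
Proof.
case: j => [|j]; first by lra.
rewrite -!natrX -natrM ltr_nat; set k := j.+1.
have le1 : (k.+2 ^ (2 * k + 4) <= k.+3 ^ (2 * k + 4))%N by rewrite leq_exp2r//; lia.
(* Here k + 3 >= 4 = 2^2. *)
have le2 : (2 ^ (2 * (4 * k ^ 2 + 18 * k + 21)) <= k.+3 ^ (4 * k ^ 2 + 18 * k + 21))%N.
  by rewrite !expnM leq_exp2r//; lia.
have -> : (4 * k ^ 2 + 20 * k + 26 = (2 * k + 4) + (4 * k ^ 2 + 18 * k + 21) + 1)%N by lia.
rewrite [ltnRHS]expnD expn1 [X in (_ < X * _)%N]expnD [ltnLHS]mulnC.
apply: (@leq_ltn_trans (k.+3 ^ (2 * k + 4) * k.+3 ^ (4 * k ^ 2 + 18 * k + 21))%N).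
  apply: leq_mul; first exact: le1.
  apply: leq_trans le2; rewrite leq_exp2l//; nia.
by rewrite ltn_Pmulr// muln_gt0 !expn_gt0.
Qed.

Lemma ln_pow_ineq (a b c : nat) (u v w : nat) : (0 < a)%N -> (0 < b)%N -> (0 < c)%N ->
  (a%:R : R) ^+ u * b%:R ^+ v < c%:R ^+ w ->
  u%:R * ln (a%:R : R) + v%:R * ln b%:R < w%:R * ln c%:R.
Proof.
move=> a0 b0 c0; rewrite -ltr_ln ?posrE ?mulr_gt0 ?exprn_gt0 ?ltr0n//.
by rewrite lnM ?posrE ?exprn_gt0 ?ltr0n// !lnXn ?ltr0n// !mulr_natl.
Qed.

(** As a single exponential the bound has an exponent linear in the logarithms, so comparisons
    reduce to linear arithmetic. *)
Lemma bound1E (s f n : nat) (L := ln 2 : R) (Ls := ln s%:R : R) (Lf := ln f%:R : R)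
    (Ln := ln n%:R : R) : (0 < s)%N -> (0 < f)%N -> (0 < n)%N ->
  2 `^ (- f%:R ^+ 2 * log2 (s%:R * f%:R / 4)
              + f%:R * log2 (s%:R / 2) - 3 / 2 * log2 (4 * f%:R))
          * n%:R `^ (- f%:R ^+ 2 + f%:R - 1) =
  expR (- f%:R ^+ 2 * (Ls + Lf - 2 * L) + f%:R * (Ls - L) - 3 / 2 * (2 * L + Lf)
    + (- f%:R ^+ 2 + f%:R - 1) * Ln).
Proof.
move=> s0 f0 n0.
have L0 : L != 0 by rewrite gt_eqF// ln_gt0// ltr1n.
have L4 : ln (4 : R) = 2 * L.
  by rewrite (_ : 4 = 2 ^+ 2) ?lnXn ?ltr0n// ?mulr_natl//; lra.
have e1 : ln (s%:R * f%:R / 4 : R) = Ls + Lf - 2 * L.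
  by rewrite ln_div ?posrE ?mulr_gt0 ?ltr0n// lnM ?posrE ?ltr0n// L4.
have e2 : ln (s%:R / 2 : R) = Ls - L by rewrite ln_div ?posrE ?ltr0n.
have e3 : ln (4 * f%:R : R) = 2 * L + Lf by rewrite lnM ?posrE ?ltr0n// L4.
rewrite /powR !pnatr_eq0 (gtn_eqF n0) -/L -/Ln /= -expRD; congr expR; congr (_ + _).
rewrite /log2 e1 e2 e3 -/L; field; exact: L0.
Qed.

Lemma bound2E (s n : nat) (L := ln 2 : R) (Ls := ln s%:R : R) (Ln := ln n%:R : R) :
  (0 < s)%N -> (0 < n)%N ->
  2 `^ (- (2 * s%:R ^+ 2 - s%:R + 1) * log2 (s%:R / 2))
          * n%:R `^ (- s%:R ^+ 2 + s%:R - 1 / 2) =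
  expR (- (2 * s%:R ^+ 2 - s%:R + 1) * (Ls - L) + (- s%:R ^+ 2 + s%:R - 1 / 2) * Ln).
Proof.
move=> s0 n0.
have L0 : L != 0 by rewrite gt_eqF// ln_gt0// ltr1n.
rewrite /powR !pnatr_eq0 (gtn_eqF n0) -/L -/Ln /= -expRD; congr expR; congr (_ + _).
by rewrite /log2 -/L ln_div ?posrE ?ltr0n// -/L -/Ls; field.
Qed.

Lemma ln_nat_ge0 (n : nat) : (0 < n)%N -> 0 <= ln (n%:R : R).
Proof. by move=> n0; rewrite ln_ge0// ler1n. Qed.

(* The constant of [sparse_convolution_ge] for [N = 2 s n f] (where [f.+1] is the [f] of
   the theorem), with the last factor replaced by its lower bound [1/2]. *)
Lemma generic_alpha_le (m s f : nat) (alpha := expR (- (ln 2 / 2) - ln f.+1%:R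
    - f%:R * (ln s%:R + ln m.+1%:R + ln f%:R)) : R) : (0 < s)%N -> (0 < f)%N ->
  alpha ^+ 2 <= (f.+1%:R^-1 * (2 / (2 * s * m.+1 * f)%:R) ^+ f) ^+ 2 *
    (1 - (s * m * f)%:R / (2 * s * m.+1 * f)%:R).
Proof.
move=> s0 f0.
have -> : alpha ^+ 2 = (f.+1%:R^-1 * (2 / (2 * s * m.+1 * f)%:R) ^+ f) ^+ 2 * 2^-1.
  have -> : 2 / (2 * s * m.+1 * f)%:R = (s%:R * m.+1%:R * f%:R)^-1 :> R.
    by rewrite -!mulnA natrM invfM mulrA divff ?pnatr_eq0// mul1r !natrM mulrA.
  rewrite /alpha -expRM_natl mulrBr mulrBr mulrN.
  rewrite (_ : 2 * (ln 2 / 2) = ln 2); last by field.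
  rewrite -!(opprD) expRN.
  set A := f.+1%:R^-1 * _; have A0 : 0 < A.
    by rewrite /A mulr_gt0 ?exprn_gt0 ?invr_gt0 ?mulr_gt0 ?ltr0n.
  rewrite -[RHS](lnK (_ : A ^+ 2 * 2^-1 \is Num.pos)); last first.
    by rewrite posrE mulr_gt0 ?exprn_gt0 ?invr_gt0.
  rewrite lnM ?posrE ?exprn_gt0 ?invr_gt0// lnXn// lnV ?posrE//.
  rewrite -expRN; congr expR.
  rewrite /A lnM ?posrE ?exprn_gt0 ?invr_gt0 ?mulr_gt0 ?ltr0n// lnXn; last first.
    by rewrite invr_gt0 !mulr_gt0 ?ltr0n.
  rewrite !lnV ?posrE ?mulr_gt0 ?ltr0n// !lnM ?posrE ?mulr_gt0 ?ltr0n//.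
  by rewrite -[_ *+ f]mulr_natl; ring.
rewrite ler_wpM2l ?sqr_ge0// lerBrDr -lerBrDl.
have D0 : 0 < (2 * s * m.+1 * f)%:R :> R by rewrite ltr0n; nia.
rewrite ler_pdivrMr// (_ : 1 - 2^-1 = 2^-1) ?ler_pdivlMl//; last by lra.
by rewrite -natrM ler_nat; nia.
Qed.

Lemma bound1_lt_generic (s f n : nat) : (0 < s)%N -> (0 < f)%N -> (0 < n)%N ->
  2 `^ (- f.+1%:R ^+ 2 * log2 (s%:R * f.+1%:R / 4)
              + f.+1%:R * log2 (s%:R / 2) - 3 / 2 * log2 (4 * f.+1%:R))
          * n%:R `^ (- f.+1%:R ^+ 2 + f.+1%:R - 1)
  < expR (- (ln 2 / 2) - ln f.+1%:R - f%:R * (ln s%:R + ln n%:R + ln f%:R)) :> R.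
Proof.
move=> s0 f0 n0; rewrite bound1E// ltr_expR.
have := @ln_nat_ge0 s s0; have := @ln_nat_ge0 n n0.
case: f f0 => // j _; have := @ln_pow_ineq 2 j.+1 j.+2 _ _ _ isT isT isT (pow_ineq_bound1 j).
have -> : (4 * j ^ 2 + 14 * j + 7)%:R = 4 * j%:R ^+ 2 + 14 * j%:R + 7 :> R by ring.
have -> : (2 * j ^ 2 + 8 * j + 9)%:R = 2 * j%:R ^+ 2 + 8 * j%:R + 9 :> R by ring.
have -> : (2 * j + 2)%:R = 2 * j%:R + 2 :> R by ring.
move: (ln 2) (ln s%:R) (ln n%:R) (ln j.+1%:R) (ln j.+2%:R) => L Ls Ln L1 L2 h Ln0 Ls0.
have -> : j.+2%:R = j%:R + 2 :> R by ring.
have -> : j.+1%:R = j%:R + 1 :> R by ring.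
move: (j%:R : R) (ler0n R j) h => J J0 h.
have Jn : 0 <= (J ^+ 2 + 2 * J + 2) * Ln by rewrite mulr_ge0// !addr_ge0 ?mulr_ge0 ?sqr_ge0.
have Js : 0 <= (J ^+ 2 + 2 * J + 1) * Ls by rewrite mulr_ge0// !addr_ge0 ?mulr_ge0 ?sqr_ge0.
by lra.
Qed.

(** The coefficient of ln n is favourable, and [pow_ineq_bound2] settles the rest. For sparsity 2
    its analogue would read 2^15 < 2^10, so the range starts at 3. *)
Lemma bound2_lt_generic (s n : nat) : (2 <= s)%N -> (0 < n)%N ->
  2 `^ (- (2 * s.+1%:R ^+ 2 - s.+1%:R + 1) * log2 (s.+1%:R / 2))
          * n%:R `^ (- s.+1%:R ^+ 2 + s.+1%:R - 1 / 2)
  < expR (- (ln 2 / 2) - ln s.+1%:R - s%:R * (ln s.+1%:R + ln n%:R + ln s%:R)) :> R.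
Proof.
move=> s2 n0; rewrite bound2E// ltr_expR.
have := @ln_nat_ge0 n n0.
case: s s2 => [|[|j]] // _.
have := @ln_pow_ineq 2 j.+2 j.+3 _ _ _ isT isT isT (pow_ineq_bound2 j).
have -> : (4 * j ^ 2 + 22 * j + 33)%:R = 4 * j%:R ^+ 2 + 22 * j%:R + 33 :> R by ring.
have -> : (4 * j ^ 2 + 20 * j + 26)%:R = 4 * j%:R ^+ 2 + 20 * j%:R + 26 :> R by ring.
have -> : (2 * j + 4)%:R = 2 * j%:R + 4 :> R by ring.
move: (ln 2) (ln n%:R) (ln j.+2%:R) (ln j.+3%:R) => L Ln L1 L2 h Ln0.
have -> : j.+3%:R = j%:R + 3 :> R by ring.
have -> : j.+2%:R = j%:R + 2 :> R by ring.
move: (j%:R : R) (ler0n R j) h => J J0 h.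
have Jn : 0 <= (J ^+ 2 + 4 * J + 2^-1) * Ln.
  by rewrite mulr_ge0// !addr_ge0 ?mulr_ge0 ?sqr_ge0 ?invr_ge0.
by lra.
Qed.

(* For [s = f = 2] and small [n] the choice [N = 2 s n (f - 1)] is too coarse; here [alpha]
   comes from [N = 4 n - 5] with [n = m.+2]. *)
Lemma bound2_lt_two (m : nat) (alpha := Num.sqrt ((2 * m + 1)%:R / (4 * m + 3)%:R ^+ 3) : R) :
  2 `^ (- (2 * 2 ^+ 2 - 2 + 1) * log2 (2 / 2)) * m.+2%:R `^ (- 2 ^+ 2 + 2 - 1 / 2) < alpha.
Proof.
rewrite (@bound2E 2 m.+2)//; set Ln := ln m.+2%:R.
rewrite (_ : _ + _ = - (5 / 2 * Ln)); last by field.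
rewrite -(@ltr_pXn2r _ 2)// ?nnegrE ?sqrtr_ge0 ?expR_ge0// /alpha sqr_sqrtr ?divr_ge0//.
rewrite -expRM_natl (_ : 2%:R * _ = - (Ln *+ 5)); last by rewrite -mulr_natl; field.
rewrite -lnXn ?ltr0n// expRN lnK ?posrE ?exprn_gt0 ?ltr0n//.
(* What remains is (4m+3)^3 < (2m+1) (m+2)^5, which at m = 0 reads 27 < 32. *)
rewrite ltr_pdivlMr; last by rewrite exprn_gt0// ltr0n; lia.
rewrite ltr_pdivrMl; last by rewrite exprn_gt0// ltr0n.
by rewrite -!natrX -natrM ltr_nat; nia.
Qed.

(** The two sides are 2^(-9/2) n^(-3) and n^(-5/2). *)
Lemma bound1_lt_bound2_two (n : nat) : (0 < n)%N ->
  2 `^ (- 2 ^+ 2 * log2 (2 * 2 / 4) + 2 * log2 (2 / 2) - 3 / 2 * log2 (4 * 2))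
          * n%:R `^ (- 2 ^+ 2 + 2 - 1)
  < 2 `^ (- (2 * 2 ^+ 2 - 2 + 1) * log2 (2 / 2)) * n%:R `^ (- 2 ^+ 2 + 2 - 1 / 2) :> R.
Proof.
move=> n0; rewrite (@bound1E 2 2 n)// (@bound2E 2 n)// ltr_expR.
have := @ln_nat_ge0 n n0; have : 0 < ln (2 : R) by rewrite ln_gt0// ltr1n.
by move: (ln _) (ln _) => L Ln; nra.
Qed.

(** The left side equals 1 / (4n). *)
Lemma bound1_one_lt1 (s n : nat) : (0 < s)%N -> (0 < n)%N ->
  2 `^ (- 1 ^+ 2 * log2 (s%:R * 1 / 4) + 1 * log2 (s%:R / 2) - 3 / 2 * log2 (4 * 1))
          * n%:R `^ (- 1 ^+ 2 + 1 - 1) < 1 :> R.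
Proof.
move=> s0 n0; rewrite (@bound1E s 1 n)// -[ltRHS]expR0 ltr_expR ln1.
have := @ln_nat_ge0 n n0; have : 0 < ln (2 : R) by rewrite ln_gt0// ltr1n.
by move: (ln _) (ln _) (ln _) => L Ln Ls; nra.
Qed.

(** The left side is 4 / sqrt n, whence the threshold 16. *)
Lemma bound2_one_lt1 (n : nat) : (16 < n)%N ->
  2 `^ (- (2 * 1 ^+ 2 - 1 + 1) * log2 (1 / 2)) * n%:R `^ (- 1 ^+ 2 + 1 - 1 / 2) < 1 :> R.
Proof.
move=> n16; have n0 : (0 < n)%N by apply: leq_trans n16.
rewrite (@bound2E 1 n)// -[ltRHS]expR0 ltr_expR ln1.
have : ln (16%:R : R) < ln n%:R by rewrite ltr_ln ?posrE ?ltr0n// ltr_nat.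
rewrite (_ : 16 = 2 ^+ 4) ?lnXn//; last by rewrite -natrX.
by move: (ln _) (ln _) => L Ln; lra.
Qed.

End Constants.

(** Unit vectors x = y force alpha <= 1. The second bound is 4 / sqrt n for s = f = 1 and equals 1
    for s = f = 2, n = 1, so a strict inequality is impossible in the excluded ranges. *)
Theorem theorem3 (R : realType) (s f n : nat)
  (s_gt0 : (0 < s)%N) (f_gt0 : (0 < f)%N) (n_gt0 : (0 < n)%N) :
  exists alpha : R,
    [/\ (forall x y : 'rV[R[i]%C]_n, Sigma R s n x -> Sigma R f n y ->
          (alpha%:E * lpnorm 2 (extZ x) * lpnorm 1 (extZ y)
             <= lpnorm 2 (convolution (extZ x) (extZ y)))%E),
        2 `^ (- f%:R ^+ 2 * log2 (s%:R * f%:R / 4)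
              + f%:R * log2 (s%:R / 2) - 3 / 2 * log2 (4 * f%:R))
          * n%:R `^ (- f%:R ^+ 2 + f%:R - 1) < alpha
      & s = f ->
        (* the two degenerate ranges where the bound below is at least 1 *)
        ~ (s = 1%N /\ (n <= 16)%N) -> ~ (s = 2%N /\ n = 1%N) ->
        2 `^ (- (2 * s%:R ^+ 2 - s%:R + 1) * log2 (s%:R / 2))
          * n%:R `^ (- s%:R ^+ 2 + s%:R - 1 / 2) < alpha].
Proof.
case: n n_gt0 => // m _; case: f f_gt0 => // f _.
have [->|f_neq0] := eqVneq f 0%N.
  (* Here y has at most one nonzero entry, so convolution by y only shifts and scales. *)
  exists 1; split.
  - apply: (@sparse_convolution_ge R m s 0 (2 * m.+1)) => //; try lia.
    by rewrite muln0 expr0 invr1 mul0r subr0 !mulr1.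
  - exact: bound1_one_lt1.
  - move=> -> n16 _; apply: bound2_one_lt1; rewrite ltnNge; apply/negP => h.
    by apply: n16.
have f_gt0 : (0 < f)%N by rewrite lt0n.
have [/andP[/andP[/eqP-> /eqP->] m_gt0]|special] := boolP ((s == 2) && (f == 1) && (0 < m))%N.
  case: m m_gt0 => // m _.
  (* With N = 4m + 3 and n - 1 = m + 1 the squared constant is (1/N)^2 (1 - (2m+2)/N) = (2m+1) /
     N^3. *)
  exists (Num.sqrt ((2 * m + 1)%:R / (4 * m + 3)%:R ^+ 3)); split.
  - apply: (@sparse_convolution_ge R m.+1 2 1 (4 * m + 3)) => //; try lia.
    rewrite sqr_sqrtr ?divr_ge0 ?exprn_ge0//.
    have D0 : (4 * m + 3)%:R != 0 :> R by rewrite pnatr_eq0; lia.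
    rewrite le_eqVlt; apply/orP; left; apply/eqP.
    by move: D0; rewrite !natrD !natrM -natr1 => D0; field.
  - by apply: lt_trans (@bound2_lt_two R m); exact: bound1_lt_bound2_two.
  - by move=> _ _ _; exact: bound2_lt_two.
exists (expR (- (ln 2 / 2) - ln f.+1%:R - f%:R * (ln s%:R + ln m.+1%:R + ln f%:R))); split.
- apply: (@sparse_convolution_ge R m s f (2 * s * m.+1 * f)); [nia|nia|exact: expR_ge0|].
  exact: generic_alpha_le.
- exact: bound1_lt_generic.
- move=> sf _ s2; subst s; apply: bound2_lt_generic => //.
  (* Were [f] equal to 1, then s = 2, and the failed test leaves only n = 1, which is excluded. *)
  rewrite ltn_neqAle f_gt0 andbT; apply/eqP => f1; subst f.
  by case: m special s2 => [_ []|m].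
Qed.
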